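(* Let $\mathcal{L}$ be a unimodal signature. The class of $\mathcal{L}$-unimodal algebras is the universal class generated by the complex algebras of all $\mathcal{L}$-unimodal frames, i.e. an $\mathcal{L}$-modal algebra is $\mathcal{L}$-unimodal if and only if it satisfies every universal sentence (in the signature of bounded lattices together with $\mathcal{L}$) that holds in the complex algebras of all $\mathcal{L}$-unimodal frames. The same holds for Heyting (respectively bi-Heyting) $\mathcal{L}$-unimodal algebras, with complex algebras equipped with their Heyting implication (respectively Heyting implication and co-implication).
   Context: Modal symbols: $\Box_{+},\Box_{-},\Diamond_{+},\Diamond_{-}$; a unimodal signature $\mathcal{L}$ is a subset of these. An $\mathcal{L}$-modal algebra is a bounded distributive lattice with one unary operation per symbol in $\mathcal{L}$ satisfying the applicable identities $\Box_{+}(a\wedge b)=\Box_{+}a\wedge\Box_{+}b$, $\Box_{+}\top=\top$; $\Box_{-}(a\vee b)=\Box_{-}a\wedge\Box_{-}b$, $\Box_{-}\bot=\top$; $\Diamond_{+}(a\vee b)=\Diamond_{+}a\vee\Diamond_{+}b$, $\Diamond_{+}\bot=\bot$; $\Diamond_{-}(a\wedge b)=\Diamond_{-}a\vee\Diamond_{-}b$, $\Diamond_{-}\top=\bot$. An $\mathcal{L}$-unimodal algebra is an $\mathcal{L}$-modal algebra satisfying, for all $a,b,c$, each of the following whose two labelling symbols belong to $\mathcal{L}$: $(\Box_{+},\Box_{-})$: $\Box_{-}a\wedge\Box_{+}(a\vee b)\leq\Box_{+}b$; $(\Box_{-},\Box_{+})$: $\Box_{+}a\wedge\Box_{-}(a\wedge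 b)\leq\Box_{-}b$; $(\Diamond_{+},\Diamond_{-})$: $\Diamond_{+}b\leq\Diamond_{+}(a\wedge b)\vee\Diamond_{-}a$; $(\Diamond_{-},\Diamond_{+})$: $\Diamond_{-}b\leq\Diamond_{-}(a\vee b)\vee\Diamond_{+}a$; $(\Box_{+},\Diamond_{-})$: $\Diamond_{-}a\wedge c\leq\Box_{+}a\Rightarrow c\leq\Box_{+}a$; $(\Box_{-},\Diamond_{+})$: $\Diamond_{+}a\wedge c\leq\Box_{-}a\Rightarrow c\leq\Box_{-}a$; $(\Diamond_{+},\Box_{-})$: $\Diamond_{+}a\leq\Box_{-}a\vee c\Rightarrow\Diamond_{+}a\leq c$; $(\Diamond_{-},\Box_{+})$: $\Diamond_{-}a\leq\Box_{+}a\vee c\Rightarrow\Diamond_{-}a\leq c$; $(\Box_{+},\Diamond_{+})$: $\Diamond_{+}b\wedge c\leq\Box_{+}a\Rightarrow\Box_{+}(a\vee b)\wedge c\leq\Box_{+}a$; $(\Box_{-},\Diamond_{-})$: $\Diamond_{-}b\wedge c\leq\Box_{-}a\Rightarrow\Box_{-}(a\wedge b)\wedge c\leq\Box_{-}a$; $(\Diamond_{+},\Box_{+})$: $\Diamond_{+}a\leq\Box_{+}b\vee c\Rightarrow\Diamond_{+}a\leq\Diamond_{+}(a\wedge b)\vee c$; $(\Diamond_{-},\Box_{-})$: $\Diamond_{-}a\leq\Box_{-}b\vee c\Rightarrow\Diamond_{-}a\leq\Diamond_{-}(a\vee b)\vee c$. A (bi-)Heyting $\mathcal{L}$-unimodal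 algebra is an $\mathcal{L}$-unimodal algebra which is also a Heyting algebra (with $\rightarrow$: $a\wedge b\leq c\iff b\leq a\rightarrow c$), resp. also has a co-implication $-$ with $a\leq b\vee c\iff a-b\leq c$. Frames: $x\,(S\circ T)\,z$ iff $xSy$, $yTz$ for some $y$. On a poset $(W,\leq)$, $R$ is a $\Box_{+}$-relation if ${\leq}\circ R\circ{\leq}\subseteq R$, $\Box_{-}$-relation if ${\leq}\circ R\circ{\geq}\subseteq R$, $\Diamond_{+}$-relation if ${\geq}\circ R\circ{\geq}\subseteq R$, $\Diamond_{-}$-relation if ${\geq}\circ R\circ{\leq}\subseteq R$; $\Box_{+}[R]={\leq}\circ R\circ{\leq}$, $\Box_{-}[R]={\leq}\circ R\circ{\geq}$, $\Diamond_{+}[R]={\geq}\circ R\circ{\geq}$, $\Diamond_{-}[R]={\geq}\circ R\circ{\leq}$. An $\mathcal{L}$-modal frame is a poset with a $\Delta_\alpha$-relation $R^{\Delta}_{\alpha}$ for each $\Delta_\alpha\in\mathcal{L}$; it is $\mathcal{L}$-unimodal if some $R$ satisfies $R^{\Delta}_{\alpha}=\Delta_\alpha[R]$ for all $\Delta_\alpha\in\mathcal{L}$. Its complex algebra is the lattice of upsets with $\Box_{+}a=\{u:\forall v\,(uR^{\Box}_{+}v\Rightarrow v\in a)\}$, $\Box_{-}a=\{u:\forall v\,(uR^{\Box}_{-}v\Rightarrow v\notin a)\}$, $\Diamond_{+}a=\{u:\exists v\in a,\ uR^{\Diamond}_{+}v\}$, $\Diamond_{-}a=\{u:\exists v\notin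 a,\ uR^{\Diamond}_{-}v\}$, and, when needed, $a\rightarrow b=\{u:\forall v\geq u\,(v\in a\Rightarrow v\in b)\}$, $a-b=\{u:\exists v\leq u,\ v\in a,\ v\notin b\}$. *)

(* Defs.v *)
From HB Require Import structures.
From mathcomp Require Import all_boot all_order.
From mathcomp Require Import boolp classical_sets.

Set Implicit Arguments.
Unset Strict Implicit.
Unset Printing Implicit Defensive.

Import Order.TTheory.
Export SetOrder.Exports.
Local Open Scope order_scope.

Inductive modsym := BoxP | BoxM | DiaP | DiaM.

(* The extra lattice operations of the similarity type: none, Heyting
   implication, or Heyting implication and co-implication. *)
Inductive expansion := Plain | Heyting | BiHeyting.

Definition has_imp (e : expansion) : bool :=
  if e is Plain then false else true.

Definition has_coimp (e : expansion) : bool :=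
  if e is BiHeyting then true else false.

Definition modal_identities (d : Order.disp_t) (A : tbDistrLatticeType d)
    (s : modsym) (f : A -> A) : Prop :=
  match s with
  | BoxP => (forall a b, f (a `&` b) = f a `&` f b) /\ f \top = \top
  | BoxM => (forall a b, f (a `|` b) = f a `&` f b) /\ f \bot = \top
  | DiaP => (forall a b, f (a `|` b) = f a `|` f b) /\ f \bot = \bot
  | DiaM => (forall a b, f (a `&` b) = f a `|` f b) /\ f \top = \bot
  end.

(* [modalAlgebra L Plain], [modalAlgebra L Heyting] and
   [modalAlgebra L BiHeyting] are respectively the L-modal algebras, the
   Heyting L-modal algebras and the bi-Heyting L-modal algebras.  Operations
   exist only for the symbols that belong to the similarity type. *)
Record modalAlgebra (L : {pred modsym}) (e : expansion) := ModalAlgebra {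
  alg_disp : Order.disp_t;
  alg_sort :> tbDistrLatticeType alg_disp;
  mop : forall s, s \in L -> alg_sort -> alg_sort;
  imp : has_imp e -> alg_sort -> alg_sort -> alg_sort;
  coimp : has_coimp e -> alg_sort -> alg_sort -> alg_sort;
  mopP : forall s (sL : s \in L), modal_identities s (mop sL);
  impP : forall (h : has_imp e) (a b c : alg_sort),
    a `&` b <= c <-> b <= imp h a c;
  coimpP : forall (h : has_coimp e) (a b c : alg_sort),
    a <= b `|` c <-> coimp h a b <= c
}.

Record unimodal (L : {pred modsym}) (e : expansion) (A : modalAlgebra L e) :
    Prop := Unimodal {
  uni_BoxP_BoxM : forall (bp : BoxP \in L) (bm : BoxM \in L) (a b : A),
    mop bm a `&` mop bp (a `|` b) <= mop bp b;
  uni_BoxM_BoxP : forall (bm : BoxM \in L) (bp : BoxP \in L) (a b : A),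
    mop bp a `&` mop bm (a `&` b) <= mop bm b;
  uni_DiaP_DiaM : forall (dp : DiaP \in L) (dm : DiaM \in L) (a b : A),
    mop dp b <= mop dp (a `&` b) `|` mop dm a;
  uni_DiaM_DiaP : forall (dm : DiaM \in L) (dp : DiaP \in L) (a b : A),
    mop dm b <= mop dm (a `|` b) `|` mop dp a;
  uni_BoxP_DiaM : forall (bp : BoxP \in L) (dm : DiaM \in L) (a c : A),
    mop dm a `&` c <= mop bp a -> c <= mop bp a;
  uni_BoxM_DiaP : forall (bm : BoxM \in L) (dp : DiaP \in L) (a c : A),
    mop dp a `&` c <= mop bm a -> c <= mop bm a;
  uni_DiaP_BoxM : forall (dp : DiaP \in L) (bm : BoxM \in L) (a c : A),
    mop dp a <= mop bm a `|` c -> mop dp a <= c;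
  uni_DiaM_BoxP : forall (dm : DiaM \in L) (bp : BoxP \in L) (a c : A),
    mop dm a <= mop bp a `|` c -> mop dm a <= c;
  uni_BoxP_DiaP : forall (bp : BoxP \in L) (dp : DiaP \in L) (a b c : A),
    mop dp b `&` c <= mop bp a -> mop bp (a `|` b) `&` c <= mop bp a;
  uni_BoxM_DiaM : forall (bm : BoxM \in L) (dm : DiaM \in L) (a b c : A),
    mop dm b `&` c <= mop bm a -> mop bm (a `&` b) `&` c <= mop bm a;
  uni_DiaP_BoxP : forall (dp : DiaP \in L) (bp : BoxP \in L) (a b c : A),
    mop dp a <= mop bp b `|` c -> mop dp a <= mop dp (a `&` b) `|` c;
  uni_DiaM_BoxM : forall (dm : DiaM \in L) (bm : BoxM \in L) (a b c : A),
    mop dm a <= mop bm b `|` c -> mop dm a <= mop dm (a `|` b) `|` c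
}.

Section UniversalSentences.
Variables (L : {pred modsym}) (e : expansion).

Inductive term :=
  | Var of nat
  | TTop
  | TBot
  | TMeet of term & term
  | TJoin of term & term
  | TMod s of s \in L & term
  | TImp of has_imp e & term & term
  | TCoimp of has_coimp e & term & term.

Inductive qf_formula :=
  | FEq of term & term
  | FFalse
  | FNot of qf_formula
  | FAnd of qf_formula & qf_formula
  | FOr of qf_formula & qf_formula
  | FImplies of qf_formula & qf_formula.

Variable A : modalAlgebra L e.

Fixpoint eval (v : nat -> A) (t : term) : A :=
  match t with
  | Var n => v n
  | TTop => \top
  | TBot => \bot
  | TMeet t u => eval v t `&` eval v u
  | TJoin t u => eval v t `|` eval v u
  | TMod _ sL t => mop sL (eval v t)
  | TImp h t u => imp h (eval v t) (eval v u)
  | TCoimp h t u => coimp h (eval v t) (eval v u)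
  end.

Fixpoint holds (v : nat -> A) (phi : qf_formula) : Prop :=
  match phi with
  | FEq t u => eval v t = eval v u
  | FFalse => False
  | FNot f => ~ holds v f
  | FAnd f g => holds v f /\ holds v g
  | FOr f g => holds v f \/ holds v g
  | FImplies f g => holds v f -> holds v g
  end.

(* A universal sentence is represented by its quantifier-free matrix, all of
   whose variables are universally quantified. *)
Definition satisfies (phi : qf_formula) : Prop :=
  forall v : nat -> A, holds v phi.

End UniversalSentences.

Section Relations.
Variables (d : Order.disp_t) (W : porderType d).
Implicit Types (R S T : W -> W -> Prop).

Definition rcomp S T : W -> W -> Prop := fun x z => exists2 y, S x y & T y z.

Definition leW : W -> W -> Prop := fun x y => x <= y.
Definition geW : W -> W -> Prop := fun x y => y <= x.

(* Delta_alpha[R] *)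
Definition sym_closure (s : modsym) R : W -> W -> Prop :=
  match s with
  | BoxP => rcomp (rcomp leW R) leW
  | BoxM => rcomp (rcomp leW R) geW
  | DiaP => rcomp (rcomp geW R) geW
  | DiaM => rcomp (rcomp geW R) leW
  end.

Definition sym_relation (s : modsym) R : Prop :=
  forall x y, sym_closure s R x y -> R x y.

End Relations.

Record frame (L : {pred modsym}) := Frame {
  fr_disp : Order.disp_t;
  fr_sort :> porderType fr_disp;
  fr_rel : forall s, s \in L -> fr_sort -> fr_sort -> Prop;
  fr_relP : forall s (sL : s \in L), sym_relation s (fr_rel sL)
}.

Definition unimodal_frame (L : {pred modsym}) (F : frame L) : Prop :=
  exists R : F -> F -> Prop,
    forall s (sL : s \in L) (x y : F),
      fr_rel sL x y <-> sym_closure s R x y.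

Section Upsets.
Variables (d : Order.disp_t) (W : porderType d).

Definition is_upset (a : set W) : Prop := forall x y, x <= y -> a x -> a y.

Definition upset_pred : {pred set W} := [pred a | `[< is_upset a >]].

Record upset := Upset { upset_val :> set W; _ : upset_val \in upset_pred }.

HB.instance Definition _ := [isSub for upset_val].
HB.instance Definition _ := [Choice of upset by <:].

Lemma upsetP (a : upset) : is_upset a.
Proof. by case: a => a /= /asboolP. Qed.

Definition mk_upset (a : set W) (h : is_upset a) : upset :=
  @Upset a (introT (asboolP (is_upset a)) h).

Lemma upset_predI :
  {in upset_pred &, forall a b, (a `&` b)%O \in upset_pred}.
Proof.
move=> a b /asboolP ha /asboolP hb; apply/asboolP => x y xy [ax bx].
by split; [exact: ha ax | exact: hb bx].
Qed.

Lemma upset_predU :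
  {in upset_pred &, forall a b, (a `|` b)%O \in upset_pred}.
Proof.
move=> a b /asboolP ha /asboolP hb; apply/asboolP => x y xy [ax|bx].
  by left; exact: ha ax.
by right; exact: hb bx.
Qed.

Lemma upset_pred0 : (\bot : set W) \in upset_pred.
Proof. by apply/asboolP. Qed.

Lemma upset_predT : (\top : set W) \in upset_pred.
Proof. by apply/asboolP. Qed.

Fact upset_display : Order.disp_t. Proof. exact: Order.Disp tt tt. Qed.

(* The order, meets and joins of upsets are inherited from [set W], i.e. they
   are inclusion, intersection and union. *)
HB.instance Definition _ := Order.isTBLatticeClosed.Build _ _ upset_pred
  upset_predI upset_predU upset_pred0 upset_predT.
HB.instance Definition _ :=
  [SubChoice_isTBSubLattice of upset by <: with upset_display].

Lemma upset_valI (a b : upset) : upset_val (a `&` b) = (a `&` b)%classic.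
Proof. by []. Qed.

Lemma upset_valU (a b : upset) : upset_val (a `|` b) = (a `|` b)%classic.
Proof. by []. Qed.

Lemma upset_val0 : upset_val \bot = set0.
Proof. by []. Qed.

Lemma upset_val1 : upset_val \top = setT.
Proof. by []. Qed.

Lemma upset_leP (a b : upset) : reflect (a `<=` b)%classic (a <= b).
Proof. exact: asboolP. Qed.

Lemma upset_meetUl : @left_distributive upset upset Order.meet Order.join.
Proof. by move=> a b c; apply: val_inj; exact: setIUl. Qed.

HB.instance Definition _ :=
  Order.Lattice_Meet_isDistrLattice.Build upset_display upset upset_meetUl.

Lemma upset_leE (a b : upset) :
  (a <= b) <-> (forall x, upset_val a x -> upset_val b x).
Proof. by split=> /upset_leP. Qed.

Lemma upset_eqE (a b : upset) :
  (forall x, upset_val a x <-> upset_val b x) -> a = b.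
Proof.
by move=> h; apply: le_anti; apply/andP; split; apply/upset_leE => x /h.
Qed.

Lemma upset_meetE (a b : upset) x :
  upset_val (a `&` b) x <-> upset_val a x /\ upset_val b x.
Proof. by rewrite upset_valI. Qed.

Lemma upset_joinE (a b : upset) x :
  upset_val (a `|` b) x <-> upset_val a x \/ upset_val b x.
Proof. by rewrite upset_valU. Qed.

Lemma upset_topE x : upset_val \top x <-> True.
Proof. by rewrite upset_val1. Qed.

Lemma upset_botE x : upset_val \bot x <-> False.
Proof. by rewrite upset_val0. Qed.

Definition sym_op_set (s : modsym) (R : W -> W -> Prop) (a : set W) : set W :=
  match s with
  | BoxP => [set u | forall v, R u v -> a v]%classic
  | BoxM => [set u | forall v, R u v -> ~ a v]%classic
  | DiaP => [set u | exists2 v, a v & R u v]%classic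
  | DiaM => [set u | exists2 v, ~ a v & R u v]%classic
  end.

Lemma sym_op_upset s (R : W -> W -> Prop) (a : set W) :
  sym_relation s R -> is_upset (sym_op_set s R a).
Proof.
case: s => hR x y xy /=.
- by move=> h v yv; apply: h; apply: hR; exists v => //; [exists y|exact: lexx].
- by move=> h v yv; apply: h; apply: hR; exists v => //; [exists y|exact: lexx].
- move=> [v av xv]; exists v => //; apply: hR; exists v; last exact: lexx.
  by exists x.
- move=> [v av xv]; exists v => //; apply: hR; exists v; last exact: lexx.
  by exists x.
Qed.

Definition sym_op s (R : W -> W -> Prop) (hR : sym_relation s R) (a : upset) :
    upset :=
  mk_upset (@sym_op_upset s R a hR).

Lemma sym_opP s (R : W -> W -> Prop) (hR : sym_relation s R) :
  modal_identities s (sym_op hR).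
Proof.
case: s hR => hR; split.
- move=> a b; apply: upset_eqE => x; rewrite upset_meetE /=; split.
    by move=> h; split=> v /h /upset_meetE[].
  by move=> [ha hb] v xv; apply/upset_meetE; split; [exact: ha|exact: hb].
- by apply: upset_eqE => x; rewrite upset_topE /=; split.
- move=> a b; apply: upset_eqE => x; rewrite upset_meetE /=; split.
    by move=> h; split=> v /h hv av; apply: hv; apply/upset_joinE; [left|right].
  by move=> [ha hb] v xv /upset_joinE[]; [exact: ha|exact: hb].
- by apply: upset_eqE => x; rewrite upset_topE /=; split=> // _ v _ /upset_botE.
- move=> a b; apply: upset_eqE => x; rewrite upset_joinE /=; split.
    by move=> [v /upset_joinE[av|bv] xv]; [left|right]; exists v.
  move=> [[v av xv]|[v bv xv]]; exists v => //; apply/upset_joinE.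
    by left.
  by right.
- by apply: upset_eqE => x; rewrite upset_botE /=; split=> // -[v /upset_botE].
- move=> a b; apply: upset_eqE => x; rewrite upset_joinE /=; split.
    move=> [v nab xv].
    have [av|nav] := pselect (upset_val a v); last by left; exists v.
    by right; exists v => // bv; apply: nab; apply/upset_meetE.
  by move=> [[v nv xv]|[v nv xv]]; exists v => // /upset_meetE[].
- apply: upset_eqE => x; rewrite upset_botE /=; split=> // -[v nv _].
  by apply: nv; apply/upset_topE.
Qed.

Definition imp_set (a b : set W) : set W :=
  [set u | forall v, u <= v -> a v -> b v]%classic.

Definition coimp_set (a b : set W) : set W :=
  [set u | exists v, [/\ v <= u, a v & ~ b v]]%classic.

Lemma imp_is_upset a b : is_upset (imp_set a b).
Proof. by move=> x y xy h v yv; apply: h; exact: le_trans yv. Qed.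

Lemma coimp_is_upset a b : is_upset (coimp_set a b).
Proof.
by move=> x y xy [v [vx av bv]]; exists v; split=> //; exact: le_trans xy.
Qed.

Definition upset_imp (a b : upset) : upset := mk_upset (@imp_is_upset a b).

Definition upset_coimp (a b : upset) : upset := mk_upset (@coimp_is_upset a b).

Lemma upset_impP (a b c : upset) : a `&` b <= c <-> b <= upset_imp a c.
Proof.
rewrite !upset_leE; split=> [h x bx v xv av|h x /upset_meetE[ax bx]].
  by apply: h; apply/upset_meetE; split=> //; exact: upsetP bx.
by apply: h bx _ _ ax; exact: lexx.
Qed.

Lemma upset_coimpP (a b c : upset) : a <= b `|` c <-> upset_coimp a b <= c.
Proof.
rewrite !upset_leE; split=> [h x [v [vx av nbv]]|h x ax].
  by have /upset_joinE[//|cv] := h _ av; exact: upsetP cv.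
apply/upset_joinE; have [bx|nbx] := pselect (upset_val b x); first by left.
by right; apply: h; exists x; split=> //; exact: lexx.
Qed.

End Upsets.

Definition complex_algebra (L : {pred modsym}) (F : frame L) (e : expansion) :
    modalAlgebra L e :=
  @ModalAlgebra L e upset_display (upset F)
    (fun s sL => sym_op (@fr_relP L F s sL))
    (fun _ => @upset_imp _ F)
    (fun _ => @upset_coimp _ F)
    (fun s sL => sym_opP (@fr_relP L F s sL))
    (fun _ => @upset_impP _ F)
    (fun _ => @upset_coimpP _ F).

(* Main.v *)
From HB Require Import structures.
Require Import Defs.
From mathcomp Require Import all_boot all_order.
From mathcomp Require Import boolp classical_sets.

(** Universal sentences pass to subalgebras, so it is enough to embed a
    unimodal algebra [A] into the complex algebra of a unimodal frame, and to
    check that complex algebras of unimodal frames satisfy the unimodal laws,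
    which are themselves universal sentences.

    The frame is the spectrum of prime filters of [A] with its canonical
    relations, and the witness of unimodality is the intersection [R] of these
    relations.  Given [P] and [Q] related by the [BoxP]-relation, one needs
    prime filters [P'] above [P] and [Q'] below [Q] that are [R]-related.  Take
    [P'] maximal among the filters above [P] still [BoxP]-related to [Q]; the
    laws labelled ([BoxP], _) then say exactly that the constraints on [Q'] are
    consistent.  The laws only use the modalities as maps from a target lattice
    to a source lattice, so replacing either lattice by its order dual permutes
    the four modalities transitively, and the other three cases follow. *)

Set Implicit Arguments.
Unset Strict Implicit.
Unset Printing Implicit Defensive.

Import Order.TTheory.
Local Open Scope order_scope.

(** * Prime filters and separation by Zorn's lemma *)

Section PrimeFilters.
Variables (d : Order.disp_t) (A : tbDistrLatticeType d).
Implicit Types (F I P : set A) (a b x y : A).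

Record is_filter F : Prop := IsFilter {
  filter_top : F \top;
  filterI : forall a b, F a -> F b -> F (a `&` b);
  filter_le : forall a b, a <= b -> F a -> F b }.

Record is_ideal I : Prop := IsIdeal {
  ideal_bot : I \bot;
  idealU : forall a b, I a -> I b -> I (a `|` b);
  ideal_le : forall a b, a <= b -> I b -> I a }.

(** Asking the complement to be an ideal makes properness and primality the order dual of the filter
    axioms. *)
Record prime_filter P : Prop := PrimeFilter {
  prime_filter_filter : is_filter P;
  prime_filter_compl : is_ideal (fun a => ~ P a) }.

Lemma prime_filterU P a b : prime_filter P -> P (a `|` b) -> P a \/ P b.
Proof.
move=> [_ [_ hU _]] Pab; have [Pa|nPa] := pselect (P a); first by left.
by right; apply: contrapT => nPb; exact: hU nPa nPb Pab.
Qed.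

Lemma principal_ideal b : is_ideal (fun x => x <= b).
Proof.
split=> [|x y xb yb|x y]; [exact: le0x|by rewrite leUx xb|exact: le_trans].
Qed.

Lemma maximal_filter F I :
    is_filter F -> is_ideal I -> (forall x, F x -> ~ I x) ->
  exists P, [/\ is_filter P, forall x, F x -> P x, forall x, P x -> ~ I x &
    forall Q, is_filter Q -> (forall x, P x -> Q x) ->
      (forall x, Q x -> ~ I x) -> forall x, Q x -> P x].
Proof.
move=> filF idI FI.
pose good Q := [/\ is_filter Q, forall x, F x -> Q x & forall x, Q x -> ~ I x].
(* The empty set is admitted so that the empty chain has a good union. *)
pose S : set (set A) := [set Q | Q = set0 \/ good Q]%classic.
have [] := @Zorn_bigcup A S.
  move=> C CS tot /=.
  have [[Q CQ gQ]|nC] := pselect (exists2 Q, C Q & good Q); last first.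
    left; apply/seteqP; split => // x [Q CQ Qx].
    have [Q0|gQ] := CS _ CQ; first by rewrite Q0 in Qx.
    by case: nC; exists Q.
  right; split; first split.
  - by exists Q => //; case: gQ => -[].
  - move=> a b [Q1 C1 Q1a] [Q2 C2 Q2b].
    wlog le12 : a b Q1 Q2 C1 C2 Q1a Q2b / (Q1 `<=` Q2)%classic.
      move=> W; have [l|l] := tot _ _ C1 C2; first exact: (W a b Q1 Q2).
      by rewrite meetC; exact: (W b a Q2 Q1).
    have [Q0|[[_ hI _] _ _]] := CS _ C2; first by rewrite Q0 in Q2b.
    by exists Q2 => //; apply: hI => //; exact: le12.
  - move=> a b ab [Q1 C1 Q1a].
    have [Q0|[[_ _ hle] _ _]] := CS _ C1; first by rewrite Q0 in Q1a.
    by exists Q1 => //; exact: hle ab Q1a.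
  - by move=> x Fx; exists Q => //; case: gQ => _ + _; apply.
  - move=> x [Q1 C1 Q1x].
    have [Q0|[_ _ +]] := CS _ C1; first by rewrite Q0 in Q1x.
    exact.
have gF : good F by [].
move=> P [[P0|[fP FP PI]] maxP].
  (* An empty [P] is not maximal, since the nonempty [F] is itself good. *)
  case: (maxP F); last by right.
  rewrite P0; split; first exact: sub0set.
  by move=> /(_ \top (filter_top filF)).
exists P; split=> // Q fQ PQ QI x Qx; apply: contrapT => nPx.
apply: (maxP Q); last by right; split=> // y /FP /PQ.
by split=> // /(_ _ Qx).
Qed.

(** The last clause records maximality in elementary form. It yields primality here, and the
    refinement lemma uses it again. *)
Lemma prime_filter_separation F I :
    is_filter F -> is_ideal I -> (forall x, F x -> ~ I x) ->
  exists P, [/\ prime_filter P, forall x, F x -> P x, forall x, P x -> ~ I x &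
    forall x, ~ P x -> exists2 y, P y & I (x `&` y)].
Proof.
move=> filF idI FI; have [P [fP FP PI maxP]] := maximal_filter filF idI FI.
have out x : ~ P x -> exists2 y, P y & I (x `&` y).
  move=> nPx; apply: contrapT => nex; apply: nPx.
  (* This is the filter generated by [P] and [x]. If it missed [I], maximality would put [x] in
     [P]. *)
  apply: (maxP (fun z => exists2 y, P y & x `&` y <= z)).
  - split=> [|a b [y Py ya] [z Pz zb]|a b ab [y Py ya]].
    + by exists \top; [exact: filter_top fP|exact: lex1].
    + exists (y `&` z); first exact: filterI.
      by rewrite lexI (le_trans _ ya) ?(le_trans _ zb) // leI2 ?leIl ?leIr.
    + by exists y => //; exact: le_trans ab.
  - by move=> z Pz; exists z => //; exact: leIr.
  - by move=> z [y Py yz] Iz; apply: nex; exists y => //; exact: ideal_le Iz.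
  - by exists \top; [exact: filter_top fP|rewrite meetx1].
exists P; split=> //; split=> //; split.
- by move=> P0; exact: PI P0 (ideal_bot idI).
- move=> a b /out[y Py Iay] /out[z Pz Ibz] Pab.
  (* By distributivity this element of [P] lies below the join of the meets of [a] with [y] and of
     [b] with [z], both in [I]. *)
  apply: (PI ((a `|` b) `&` (y `&` z))); first by do !apply: filterI => //.
  apply: ideal_le (idealU idI Iay Ibz) => //.
  by rewrite meetUl leU2 ?leI2 ?leIl ?leIr.
- by move=> a b ab nPb Pa; apply: nPb; exact: filter_le ab Pa.
Qed.


End PrimeFilters.


(** * Prime filters of the order dual *)

Section Dual.
Variables (d : Order.disp_t) (A : tbDistrLatticeType d).

(** Complementation exchanges the filter half and the ideal half of primality, up to double
    negation. *)
Lemma prime_filter_dual (P : set A) :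
  prime_filter P -> @prime_filter _ A^d (fun a => ~ P a).
Proof.
move=> [[f1 f2 f3] [i1 i2 i3]]; split; split.
- exact: i1.
- exact: i2.
- by move=> a b ab; exact: i3.
- exact.
- by move=> a b /contrapT Pa /contrapT Pb; apply; exact: f2.
- by move=> a b ab /contrapT Pb; apply; exact: f3 Pb.
Qed.

Lemma prime_filter_undual (P : set A^d) :
  prime_filter P -> @prime_filter _ A (fun a => ~ P a).
Proof.
move=> [[f1 f2 f3] [i1 i2 i3]]; split; split.
- exact: i1.
- exact: i2.
- by move=> a b ab; exact: i3.
- exact.
- by move=> a b /contrapT Pa /contrapT Pb; apply; exact: f2.
- by move=> a b ab /contrapT Pb; apply; exact: f3 Pb.
Qed.

End Dual.

(** * Meet-preserving maps between two lattices, and refinement of related prime filters *)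

Section MeetMaps.
Variables (dA dB : Order.disp_t).
Variables (A : tbDistrLatticeType dA) (B : tbDistrLatticeType dB).
Variable f : B -> A.
Hypothesis fI : forall a b, f (a `&` b) = f a `&` f b.
Hypothesis f1 : f \top = \top.

Lemma meet_map_le a b : a <= b -> f a <= f b.
Proof. by move=> /meet_idPl ab; apply/meet_idPl; rewrite -fI ab. Qed.

Lemma preimage_filter (P : set A) : is_filter P -> is_filter (fun b => P (f b)).
Proof.
move=> [P1 PI Ple]; split=> [|a b Pa Pb|a b ab]; first by rewrite f1.
  by rewrite fI; exact: PI.
by apply: Ple; exact: meet_map_le.
Qed.

(** The preimage of [P] along [f] is a filter, and monotonicity of [f] keeps it disjoint from the
    principal ideal of [b]. *)
Lemma prime_filter_successor (P : set A) b :
    prime_filter P -> ~ P (f b) ->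
  exists Q, [/\ prime_filter Q, forall a, P (f a) -> Q a & ~ Q b].
Proof.
move=> [fP _] nPb.
have [|Q [pQ PQ QI _]] :=
  prime_filter_separation (preimage_filter fP) (principal_ideal b).
  by move=> x Px xb; apply: nPb; apply: filter_le Px => //; exact: meet_map_le.
by exists Q; split=> // /QI; apply; exact: lexx.
Qed.

(** With [f] in the role of [BoxP], the maps [m], [p], [n] play [BoxM], [DiaP], [DiaM]. The booleans
    stand for membership in the signature, so an absent symbol imposes no condition. Keeping [A] and
    [B] distinct allows each to be dualized separately. *)
Variables (bm bp bn : bool).
Variables (m : bm -> B -> A) (p : bp -> B -> A) (n : bn -> B -> A).
Hypothesis mU : forall h a b, m h (a `|` b) = m h a `&` m h b.
Hypothesis pU : forall h a b, p h (a `|` b) = p h a `|` p h b.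
Hypothesis nI : forall h a b, n h (a `&` b) = n h a `|` n h b.
Hypothesis fm : forall h a b, m h a `&` f (a `|` b) <= f b.
Hypothesis fn : forall h a c, n h a `&` c <= f a -> c <= f a.
Hypothesis fp : forall h a b c,
  p h b `&` c <= f a -> f (a `|` b) `&` c <= f a.

(* The source is enlarged to a filter [P'] maximal among those missing every
   [f g] with [g] outside [Q]; maximality turns [~ P' x] into an inequality
   [x `&` y <= f g] with [P' y], to which the laws [fn] and [fp] apply. *)
Lemma unimodal_refinement (P : set A) (Q : set B) :
    prime_filter P -> prime_filter Q -> (forall a, P (f a) -> Q a) ->
  exists P' Q', [/\ prime_filter P' /\ prime_filter Q',
    (forall a, P a -> P' a) /\ (forall b, Q' b -> Q b),
    forall b, P' (f b) -> Q' b,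
    forall h b, P' (m h b) -> ~ Q' b &
    (forall h b, Q' b -> P' (p h b)) /\ (forall h b, ~ Q' b -> P' (n h b))].
Proof.
move=> [fP _] [_ [Q0 QU Qle]] PQ.
pose I x := exists2 g, ~ Q g & x <= f g.
have idI : is_ideal I.
  split=> [|x y [g Qg xg] [g' Qg' yg']|x y xy [g Qg yg]].
  - by exists \bot => //; exact: le0x.
  - exists (g `|` g'); first exact: QU.
    rewrite leUx (le_trans xg) ?(le_trans yg') // meet_map_le ?leUl ?leUr //.
  - by exists g => //; exact: le_trans yg.
have [|P' [pP' PP' P'I P'max]] := prime_filter_separation fP idI.
  by move=> x Px [g Qg xg]; apply/Qg/PQ; exact: filter_le xg Px.
have [fP' iP'] := pP'.
(* [M] and [C] collect what [Q'] must avoid because of [m] and [p], and [D] what it must contain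
   because of [n]. Adjoining [\bot] or [\top] keeps them nonempty when the symbol is absent. *)
pose M b := b = \bot \/ exists h, P' (m h b).
pose C b := b = \bot \/ exists h, ~ P' (p h b).
pose D b := b = \top \/ exists h, ~ P' (n h b).
have MU a b : M a -> M b -> M (a `|` b).
  move=> [->|[h ha]]; first by rewrite join0x.
  move=> [->|[k kb]]; first by rewrite joinx0; right; exists h.
  right; exists h; rewrite mU; apply: filterI => //.
  by rewrite (bool_irrelevance h k).
have CU a b : C a -> C b -> C (a `|` b).
  move=> [->|[h ha]]; first by rewrite join0x.
  move=> [->|[k kb]]; first by rewrite joinx0; right; exists h.
  right; exists h; rewrite pU; apply: (idealU iP') => //.
  by rewrite (bool_irrelevance h k).
have DI a b : D a -> D b -> D (a `&` b).
  move=> [->|[h ha]]; first by rewrite meet1x.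
  move=> [->|[k kb]]; first by rewrite meetx1; right; exists h.
  right; exists h; rewrite nI; apply: (idealU iP') => //.
  by rewrite (bool_irrelevance h k).
(* [F'] is generated by the preimage of [P'] along [f] together with [D], and [I'] by [M], [C] and
   the complement of [Q]. The point is that they are disjoint. *)
pose F' x := exists a d, [/\ P' (f a), D d & a `&` d <= x].
pose I' x := exists b c g, [/\ M b, C c, ~ Q g & x <= b `|` (c `|` g)].
have filF' : is_filter F'.
  split=> [|x y [a [e [Pa De ae]]] [a' [e' [Pa' De' ae']]]|
           x y xy [a [e [Pa De ae]]]].
  - exists \top, \top; split; [|by left|exact: lex1].
    by rewrite f1; exact: filter_top.
  - exists (a `&` a'), (e `&` e'); split; last first.
    + by rewrite meetACA leI2.
    + exact: DI.
    + by rewrite fI; exact: filterI.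
  - by exists a, e; split=> //; exact: le_trans xy.
have idI' : is_ideal I'.
  split=> [|x y [b [c [g [Mb Cc Qg xle]]]] [b' [c' [g' [Mb' Cc' Qg' yle]]]]|
           x y xy [b [c [g [Mb Cc Qg yle]]]]].
  - by exists \bot, \bot, \bot; split=> //; left.
  - exists (b `|` b'), (c `|` c'), (g `|` g'); split.
    + exact: MU.
    + exact: CU.
    + exact: QU.
    + by rewrite (joinACA c) (joinACA b) leU2.
  - by exists b, c, g; split=> //; exact: le_trans yle.
have I'x b c g x : M b -> C c -> ~ Q g -> x <= b `|` (c `|` g) -> I' x.
  by move=> *; exists b, c, g.
have F'x a e x : P' (f a) -> D e -> a `&` e <= x -> F' x.
  by move=> *; exists a, e.
have [|Q' [pQ' F'Q' Q'I' _]] := prime_filter_separation filF' idI'.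
  move=> x [a [e [Pa De aex]]] [b [c [g [Mb Cc Qg xbcg]]]].
  (* The [D]-element [e] need not have [f e] in [P'], but this holds after joining some [g1] outside
     [Q]. Maximality bounds the meet of [n h e] and some [y] in [P'] by [f g1], and, [n h] being
     antitone, [fn] applies at the join of [e] and [g1]. *)
  have [g1 Qg1 Pe] : exists2 g1, ~ Q g1 & P' (f (e `|` g1)).
    case: De => [->|[h /P'max[y Py [g1 Qg1 yg1]]]].
      by exists \bot => //; rewrite joinx0 f1; exact: filter_top.
    exists g1 => //; apply: filter_le Py => //; apply: (fn (h := h)).
    apply: (@le_trans _ _ (f g1)); last by rewrite meet_map_le ?leUr.
    apply: le_trans yg1.
    rewrite leI2 //; apply/join_idPl; rewrite -nI.
    by congr (n h _); apply/meet_idPl; rewrite leUl.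
  have Pcg : P' (f (b `|` (c `|` (g `|` g1)))).
    apply: (filter_le fP') (filterI fP' Pa Pe); rewrite -fI.
    apply: meet_map_le; rewrite meetUr leUx; apply/andP; split.
      apply: (le_trans aex); apply: (le_trans xbcg).
      by rewrite !leU2 // leUl.
    by rewrite (le_trans (leIr _ _)) // !joinA leUr.
  (* The law [fm] removes the [M]-element [b] from the join. *)
  have {}Pcg : P' (f (c `|` (g `|` g1))).
    case: Mb Pcg => [->|[h Pb] Pcg]; first by rewrite join0x.
    by apply: (filter_le fP') (filterI fP' Pb Pcg); exact: fm.
  (* Maximality and [fp] remove the [C]-element [c], leaving [f] of an element outside [Q], which
     [P'] cannot contain. *)
  have [g2 Qg2 Pg2] : exists2 g2, ~ Q g2 & P' (f g2).
    case: Cc Pcg => [->|[h /P'max[y Py [g2 Qg2 yg2]]] Pcg].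
      by rewrite join0x; exists (g `|` g1) => //; exact: QU.
    exists (g `|` g1 `|` g2); first by apply: (QU) => //; exact: QU.
    have le2 : p h c `&` y <= f (g `|` g1 `|` g2).
      by apply: (le_trans yg2); rewrite meet_map_le ?leUr.
    apply: (filter_le fP' (fp le2)); apply: filterI => //.
    apply: (filter_le fP') Pcg; apply: meet_map_le.
    by rewrite joinC leU2 // leUl.
  by apply: P'I Pg2 _; exists g2.
exists P', Q'; split=> //; first split=> //.
- move=> b Q'b; apply: contrapT => nQb; apply: Q'I' Q'b _.
  by apply: (I'x \bot \bot b) => //; [left|left|rewrite !join0x].
- by move=> b Pb; apply: F'Q'; apply: (F'x b \top) => //; [left|rewrite meetx1].
- move=> h b Pb Q'b; apply: Q'I' Q'b _.
  by apply: (I'x b \bot \bot) => //; [right; exists h|left|rewrite leUl].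
- split=> h b Q'b; apply: contrapT => nP.
    apply: Q'I' Q'b _; apply: (I'x \bot b \bot) => //.
    + by left.
    + by right; exists h.
    + by rewrite join0x leUl.
  apply: Q'b; apply: F'Q'; apply: (F'x \top b).
  + by rewrite f1; exact: filter_top.
  + by right; exists h.
  + by rewrite leIr.
Qed.

End MeetMaps.

(* Residuation makes [r a] a meet map, so the prime filter that refutes
   [r a b] above [P] is a successor of [P] along it. *)
Lemma residual_successor (d : Order.disp_t) (X : tbDistrLatticeType d)
    (r : X -> X -> X) (P : set X) a b :
    (forall x y z : X, x `&` y <= z <-> y <= r x z) ->
    prime_filter P -> ~ P (r a b) ->
  exists Q, [/\ prime_filter Q, forall x, P x -> Q x, Q a & ~ Q b].
Proof.
move=> rP pP nP; have [fP _] := pP.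
have rI x y : r a (x `&` y) = r a x `&` r a y.
  have le_r u v : u <= v -> r a u <= r a v.
    by move=> uv; apply/rP; apply: le_trans uv; apply/rP.
  apply: le_anti; apply/andP; split.
    by rewrite lexI !le_r ?leIl ?leIr.
  apply: (rP _ _ _).1; rewrite lexI.
  by apply/andP; split; apply: (rP _ _ _).2; rewrite ?leIl ?leIr.
have r1 : r a \top = \top.
  by apply: le_anti; rewrite lex1; apply/rP; exact: lex1.
have [Q [pQ PQ nQ]] := prime_filter_successor rI r1 pP nP.
exists Q; split=> //.
  by move=> x Px; apply: PQ; apply: filter_le Px => //; apply/rP; exact: leIr.
apply: PQ; apply: (filter_le fP) (filter_top fP); apply/rP; exact: leIl.
Qed.

(** * The spectrum and the representation of the algebra by upsets *)

Section Spectrum.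
Variables (d : Order.disp_t) (A : tbDistrLatticeType d).

Definition prime_pred : {pred set A} := [pred P | `[< prime_filter P >]].

Record spectrum := Spectrum {
  spectrum_val :> set A; _ : spectrum_val \in prime_pred }.

HB.instance Definition _ := [isSub for spectrum_val].
HB.instance Definition _ := [Choice of spectrum by <:].

Fact spectrum_display : Order.disp_t. Proof. exact: Order.Disp tt tt. Qed.

HB.instance Definition _ :=
  [SubChoice_isSubPOrder of spectrum by <: with spectrum_display].

Lemma spectrumP (P : spectrum) : prime_filter P.
Proof. by case: P => P /= /asboolP. Qed.

Definition mk_spectrum (P : set A) (h : prime_filter P) : spectrum :=
  @Spectrum P (introT (asboolP (prime_filter P)) h).

Lemma spectrum_leE (P Q : spectrum) :
  (P <= Q) <-> (forall a, spectrum_val P a -> spectrum_val Q a).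
Proof. by split=> /asboolP. Qed.

Definition canonical_rel (s : modsym) (f : A -> A) (P Q : spectrum) : Prop :=
  match s with
  | BoxP => forall a, spectrum_val P (f a) -> spectrum_val Q a
  | BoxM => forall a, spectrum_val P (f a) -> ~ spectrum_val Q a
  | DiaP => forall a, spectrum_val Q a -> spectrum_val P (f a)
  | DiaM => forall a, ~ spectrum_val Q a -> spectrum_val P (f a)
  end.

Lemma canonical_relP s f : sym_relation s (canonical_rel s f).
Proof.
case: s => P Q [Q' [P' /spectrum_leE PP' h] /spectrum_leE QQ'] a /=.
- by move=> /PP' /h /QQ'.
- by move=> /PP' /h + /QQ'.
- by move=> /QQ' /h /PP'.
- by move=> nQ; apply/PP'/h => /QQ'.
Qed.

(** This is the Stone representation map. *)
Definition eta_set (a : A) : set spectrum := [set P | spectrum_val P a]%classic.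

Lemma eta_upset a : is_upset (eta_set a).
Proof. by move=> P Q /spectrum_leE; apply. Qed.

Definition eta (a : A) : upset spectrum := mk_upset (@eta_upset a).

Lemma eta_inj : injective eta.
Proof.
suff le_eta a b : eta a = eta b -> a <= b.
  by move=> a b ab; apply: le_anti; rewrite !le_eta.
move=> ab; apply: contrapT => nab.
have fila : is_filter (fun x => a <= x).
  split=> [|x y ax ay|x y xy ax]; [exact: lex1|by rewrite lexI ax|].
  exact: le_trans xy.
have [|P [pP aP Pb _]] := prime_filter_separation fila (principal_ideal b).
  by move=> x ax xb; apply: nab; exact: le_trans xb.
have : upset_val (eta b) (mk_spectrum pP).
  by rewrite -ab; apply: aP; exact: lexx.
by move/Pb; apply; exact: lexx.
Qed.

Lemma eta_top : eta \top = \top.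
Proof.
apply: upset_eqE => P; rewrite upset_topE; split=> // _.
exact: filter_top (prime_filter_filter (spectrumP P)).
Qed.

Lemma eta_bot : eta \bot = \bot.
Proof.
apply: upset_eqE => P; rewrite upset_botE; split=> //.
exact: ideal_bot (prime_filter_compl (spectrumP P)).
Qed.

Lemma etaI a b : eta (a `&` b) = eta a `&` eta b.
Proof.
apply: upset_eqE => P; rewrite upset_meetE; have [fP _] := spectrumP P.
split=> [ab|[Pa Pb]]; last exact: filterI.
by split; apply: filter_le ab; rewrite // ?leIl ?leIr.
Qed.

Lemma etaU a b : eta (a `|` b) = eta a `|` eta b.
Proof.
apply: upset_eqE => P; rewrite upset_joinE; have pP := spectrumP P.
split; first exact: prime_filterU.
by have [fP _] := pP; move=> [] Px; apply: filter_le Px; rewrite ?leUl ?leUr.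
Qed.

(** The inclusions not immediate from [canonical_rel] need a related prime filter. The successor
    lemma supplies it, each symbol being a meet map once source and target are suitably dualized. *)
Lemma eta_sym s f a :
  modal_identities s f -> eta (f a) = sym_op (@canonical_relP s f) (eta a).
Proof.
move=> fs; apply: upset_eqE => P; have pP := spectrumP P.
have pP' := prime_filter_dual pP.
case: s fs => -[fM f1] /=; split.
- by move=> Pfa Q PQ; exact: PQ.
- move=> h; apply: contrapT => nP.
  have [Q [pQ PQ nQ]] := prime_filter_successor fM f1 pP nP.
  by apply: nQ; exact: (h (mk_spectrum pQ)).
- by move=> Pfa Q PQ; exact: PQ.
- move=> h; apply: contrapT => nP.
  have [Q [pQ PQ nQ]] := @prime_filter_successor _ _ A A^d f fM f1 _ _ pP nP.
  apply: (h (mk_spectrum (prime_filter_undual pQ))); last exact: nQ.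
  by move=> b Pb; apply; exact: PQ.
- move=> Pfa; apply: contrapT => nex.
  have [//|Q [pQ PQ nQ]] :=
    @prime_filter_successor _ _ A^d A^d f fM f1 _ a pP'.
  apply: nex; exists (mk_spectrum (prime_filter_undual pQ)); first exact: nQ.
  by move=> b nQb; apply: contrapT => nP; apply: nQb; exact: PQ.
- by move=> [Q Qa PQ]; exact: PQ.
- move=> Pfa; apply: contrapT => nex.
  have [//|Q [pQ PQ nQ]] :=
    @prime_filter_successor _ _ A^d A f fM f1 _ a pP'.
  apply: nex; exists (mk_spectrum pQ); first exact: nQ.
  by move=> b nQb; apply: contrapT => nP; apply: nQb; exact: PQ.
- by move=> [Q Qa PQ]; exact: PQ.
Qed.

Lemma eta_imp (r : A -> A -> A) a b :
    (forall x y z : A, x `&` y <= z <-> y <= r x z) ->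
  eta (r a b) = upset_imp (eta a) (eta b).
Proof.
move=> rP; apply: upset_eqE => P; have pP := spectrumP P; split=> /=.
  move=> Pr Q /spectrum_leE PQ Qa; have [fQ _] := spectrumP Q.
  apply: (filter_le fQ) (filterI fQ Qa (PQ _ Pr)); apply/rP; exact: lexx.
move=> h; apply: contrapT => nP.
have [Q [pQ PQ Qa nQb]] := residual_successor rP pP nP.
by apply: nQb; apply: (h (mk_spectrum pQ)) => //; apply/spectrum_leE.
Qed.

Lemma eta_coimp (r : A -> A -> A) a b :
    (forall x y z : A, x <= y `|` z <-> r x y <= z) ->
  eta (r a b) = upset_coimp (eta a) (eta b).
Proof.
move=> rP; apply: upset_eqE => P; have pP := spectrumP P; split=> /=.
  move=> Pr; apply: contrapT => nex.
  (* Co-implication with its arguments swapped is the implication of the dual lattice. *)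
  have rP' (x y z : A^d) : x `&` y <= z <-> y <= r z x by exact: rP.
  have [//|Q [pQ PQ Qb nQa]] :=
    @residual_successor _ A^d (fun x y => r y x) _ b a rP'
      (prime_filter_dual pP).
  apply: nex; exists (mk_spectrum (prime_filter_undual pQ)); split=> //.
  by apply/spectrum_leE => x nQx; apply: contrapT => nPx; apply: nQx; exact: PQ.
move=> [Q [/spectrum_leE QP Qa nQb]]; apply: QP; have pQ := spectrumP Q.
have [fQ _] := pQ; have /(prime_filterU pQ)[] // : spectrum_val Q (b `|` r a b).
by apply: filter_le Qa => //; apply/rP; exact: lexx.
Qed.

End Spectrum.

(** * The canonical frame is unimodal, and the algebra embeds in its complex algebra *)

Section CanonicalFrame.
Variables (L : {pred modsym}) (e : expansion) (A : modalAlgebra L e).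

Definition canonical_frame : frame L :=
  @Frame L spectrum_display (spectrum A)
    (fun s sL => canonical_rel s (mop sL))
    (fun s sL => @canonical_relP _ A s (mop sL)).

Lemma canonical_frame_unimodal : unimodal A -> unimodal_frame canonical_frame.
Proof.
move=> uA; exists (fun P Q => forall s (sL : s \in L),
  canonical_rel s (mop sL : A -> A) P Q) => s sL P Q; split; last first.
  (* The easy inclusion: the witness lies inside each canonical relation, which absorbs the order on
     both sides. *)
  move=> h; apply: (@canonical_relP _ A).
  by case: s sL h => sL /= [Q' [P' PP' h] QQ']; exists Q' => //; exists P'.
have [pP pQ] := (spectrumP P, spectrumP Q).
have [dP dQ] := (prime_filter_dual pP, prime_filter_dual pQ).
have bp h := @mopP L e A BoxP h; have bm h := @mopP L e A BoxM h.
have dp h := @mopP L e A DiaP h; have dm h := @mopP L e A DiaM h.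
case: s sL => sL /= PQ.
(* In the four cases the main symbol is a meet map [A -> A], [A^d -> A], [A^d -> A^d] and [A -> A^d]
   respectively. Wherever a lattice is dualized, a prime filter is replaced by its complement. *)
- have [] := @unimodal_refinement _ _ A A (mop sL) (bp sL).1 (bp sL).2
    _ _ _ (@mop L e A BoxM) (@mop L e A DiaP) (@mop L e A DiaM)
    (fun h => (bm h).1) (fun h => (dp h).1) (fun h => (dm h).1)
    (@uni_BoxP_BoxM _ _ _ uA sL) (@uni_BoxP_DiaM _ _ _ uA sL)
    (@uni_BoxP_DiaP _ _ _ uA sL)
    _ _ pP pQ PQ.
  move=> P' [Q' [[pP' pQ'] [PP' QQ'] hbp hbm [hdp hdm]]].
  exists (mk_spectrum pQ'); last by apply/spectrum_leE.
  exists (mk_spectrum pP'); first by apply/spectrum_leE.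
  case=> h /=; rewrite ?(bool_irrelevance h sL) //.
  + exact: hbm.
  + exact: hdp.
  + exact: hdm.
- have [] := @unimodal_refinement _ _ A A^d (mop sL) (bm sL).1 (bm sL).2
    _ _ _ (@mop L e A BoxP) (@mop L e A DiaM) (@mop L e A DiaP)
    (fun h => (bp h).1) (fun h => (dm h).1) (fun h => (dp h).1)
    (@uni_BoxM_BoxP _ _ _ uA sL) (@uni_BoxM_DiaP _ _ _ uA sL)
    (@uni_BoxM_DiaM _ _ _ uA sL)
    _ _ pP dQ PQ.
  move=> P' [Q' [[pP' pQ'] [PP' QQ'] hbm hbp [hdm hdp]]].
  exists (mk_spectrum (prime_filter_undual pQ')); last first.
    by apply/spectrum_leE => a Qa /QQ'; exact.
  exists (mk_spectrum pP'); first by apply/spectrum_leE.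
  case=> h /=; rewrite ?(bool_irrelevance h sL).
  + by move=> a /hbp.
  + by move=> a /hbm Qa; exact.
  + by move=> a; exact: hdp.
  + by move=> a /contrapT; exact: hdm.
(* Meets of [A^d] are joins of [A]. The join is commuted to match the argument order of [fm]. *)
- have law (h : DiaM \in L) (a b : A) :
      mop sL b <= mop h a `|` mop sL (a `&` b).
    by rewrite joinC uni_DiaP_DiaM.
  have [|] := @unimodal_refinement _ _ A^d A^d (mop sL) (dp sL).1 (dp sL).2
    _ _ _ (@mop L e A DiaM) (@mop L e A BoxP) (@mop L e A BoxM)
    (fun h => (dm h).1) (fun h => (bp h).1) (fun h => (bm h).1)
    law (@uni_DiaP_BoxM _ _ _ uA sL) (@uni_DiaP_BoxP _ _ _ uA sL)
    _ _ dP dQ.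
    by move=> a nPa Qa; apply: nPa; exact: PQ.
  move=> P' [Q' [[pP' pQ'] [PP' QQ'] hdp hdm [hbp hbm]]].
  exists (mk_spectrum (prime_filter_undual pQ')); last first.
    by apply/spectrum_leE => a Qa /QQ'; exact.
  exists (mk_spectrum (prime_filter_undual pP')).
    by apply/spectrum_leE => a nPa; apply: contrapT => /PP'.
  case=> h /=; rewrite ?(bool_irrelevance h sL) => a.
  + by move=> nP Qa; apply: nP; exact: hbp.
  + by move=> nP nQa; apply: nP; exact: hbm.
  + by move=> nQ Pa; apply: nQ; exact: hdp.
  + by move=> nQ /hdm.
- have law (h : DiaP \in L) (a b : A) :
      mop sL b <= mop h a `|` mop sL (a `|` b).
    by rewrite joinC uni_DiaM_DiaP.
  have [|] := @unimodal_refinement _ _ A^d A (mop sL) (dm sL).1 (dm sL).2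
    _ _ _ (@mop L e A DiaP) (@mop L e A BoxM) (@mop L e A BoxP)
    (fun h => (dp h).1) (fun h => (bm h).1) (fun h => (bp h).1)
    law (@uni_DiaM_BoxP _ _ _ uA sL) (@uni_DiaM_BoxM _ _ _ uA sL)
    _ _ dP pQ.
    by move=> a nPa; apply: contrapT => Qa; apply: nPa; exact: PQ.
  move=> P' [Q' [[pP' pQ'] [PP' QQ'] hdm hdp [hbm hbp]]].
  exists (mk_spectrum pQ'); last by apply/spectrum_leE.
  exists (mk_spectrum (prime_filter_undual pP')).
    by apply/spectrum_leE => a nPa; apply: contrapT => /PP'.
  case=> h /=; rewrite ?(bool_irrelevance h sL) => a.
  + by move=> nP; apply: contrapT => Qa; apply: nP; exact: hbp.
  + by move=> nP Qa; apply: nP; exact: hbm.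
  + by move=> Qa /hdp.
  + by move=> nQ Pa; apply: nQ; exact: hdm.
Qed.

Lemma eval_canonical v (t : term L e) :
  eval (A := complex_algebra canonical_frame e) (fun n => eta (v n)) t =
  eta (eval (A := A) v t).
Proof.
elim: t => [n|||t IHt u IHu|t IHt u IHu|s sL t IHt|h t IHt u IHu|h t IHt u IHu]
  /=.
- by [].
- by rewrite eta_top.
- by rewrite eta_bot.
- by rewrite IHt IHu etaI.
- by rewrite IHt IHu etaU.
- by rewrite IHt (eta_sym _ (mopP A sL)).
- by rewrite IHt IHu (eta_imp _ _ (@impP _ _ A h)).
- by rewrite IHt IHu (eta_coimp _ _ (@coimpP _ _ A h)).
Qed.

(** An equivalence is needed because formulas contain negation and implication. Injectivity of [eta]
    reflects the equations. *)
Lemma holds_canonical v (phi : qf_formula L e) :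
  holds (A := complex_algebra canonical_frame e) (fun n => eta (v n)) phi <->
  holds (A := A) v phi.
Proof.
elim: phi => [t u||f IHf|f IHf g IHg|f IHf g IHg|f IHf g IHg] /=.
- by rewrite !eval_canonical; split=> [/eta_inj|->].
all: tauto.
Qed.

End CanonicalFrame.

(** * Complex algebras of unimodal frames are unimodal *)

Section ComplexAlgebra.
Variables (L : {pred modsym}) (e : expansion) (F : frame L).
Variable R : F -> F -> Prop.
Hypothesis FR : forall s (sL : s \in L) (x y : F),
  fr_rel sL x y <-> sym_closure s R x y.
Let C := complex_algebra F e.

(** The operations are described through the generating [R]. The order step after [R] is absorbed
    because [a] is an upset, so only the step before it remains. *)
Lemma mem_BoxP (h : BoxP \in L) (a : C) x :
  upset_val (mop h a) x <-> forall y z, x <= y -> R y z -> upset_val a z.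
Proof.
split=> [H y z xy yz|H z /FR[z' [y xy yz] zz']].
  by apply: H; apply/FR; exists z; [exists y|exact: lexx].
exact: upsetP zz' (H _ _ xy yz).
Qed.

Lemma mem_BoxM (h : BoxM \in L) (a : C) x :
  upset_val (mop h a) x <-> forall y z, x <= y -> R y z -> ~ upset_val a z.
Proof.
split=> [H y z xy yz|H z /FR[z' [y xy yz] zz'] az].
  by apply: H; apply/FR; exists z; [exists y|exact: lexx].
by apply: (H _ _ xy yz); exact: upsetP zz' az.
Qed.

Lemma mem_DiaP (h : DiaP \in L) (a : C) x :
  upset_val (mop h a) x <-> exists y z, [/\ y <= x, R y z & upset_val a z].
Proof.
split=> [[z az /FR[z' [y xy yz] zz']]|[y [z [xy yz az]]]].
  by exists y, z'; split=> //; exact: upsetP zz' az.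
by exists z => //; apply/FR; exists z; [exists y|exact: lexx].
Qed.

Lemma mem_DiaM (h : DiaM \in L) (a : C) x :
  upset_val (mop h a) x <-> exists y z, [/\ y <= x, R y z & ~ upset_val a z].
Proof.
split=> [[z az /FR[z' [y xy yz] zz']]|[y [z [xy yz az]]]].
  by exists y, z'; split=> // az'; apply: az; exact: upsetP zz' az'.
by exists z => //; apply/FR; exists z; [exists y|exact: lexx].
Qed.

(** The first four laws are checked at the [R]-successor [z]. For the conditional ones the premise
    is applied at the point [y] that sees [z] directly: membership in [c] passes up from [x] to [y]
    for boxes, and from [y] to [x] for diamonds. *)
Lemma complex_algebra_unimodal : unimodal C.
Proof.
split.
- move=> bp bm a b; apply/upset_leE.
  move=> x /upset_meetE[/mem_BoxM xa /mem_BoxP xb].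
  apply/mem_BoxP => y z xy yz.
  by have /upset_joinE[/xa-/(_ _ xy yz)|] := xb _ _ xy yz.
- move=> bm bp a b; apply/upset_leE.
  move=> x /upset_meetE[/mem_BoxP xa /mem_BoxM xb].
  apply/mem_BoxM => y z xy yz bz; apply: (xb _ _ xy yz); apply/upset_meetE.
  by split=> //; exact: xa xy yz.
- move=> dp dm a b; apply/upset_leE => x /mem_DiaP[y [z [yx yz bz]]].
  apply/upset_joinE; have [az|naz] := pselect (upset_val a z).
    by left; apply/mem_DiaP; exists y, z; split=> //; apply/upset_meetE.
  by right; apply/mem_DiaM; exists y, z.
- move=> dm dp a b; apply/upset_leE => x /mem_DiaM[y [z [yx yz bz]]].
  apply/upset_joinE; have [az|naz] := pselect (upset_val a z).
    by right; apply/mem_DiaP; exists y, z.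
  by left; apply/mem_DiaM; exists y, z; split=> // /upset_joinE[].
- move=> bp dm a c /upset_leE H; apply/upset_leE => x cx.
  apply/mem_BoxP => y z xy yz; apply: contrapT => az.
  apply: (az); apply: ((mem_BoxP bp a y).1 _ y z (lexx y) yz).
  apply: H; apply/upset_meetE; split; last exact: upsetP cx.
  by apply/mem_DiaM; exists y, z.
- move=> bm dp a c /upset_leE H; apply/upset_leE => x cx.
  apply/mem_BoxM => y z xy yz az.
  apply: ((mem_BoxM bm a y).1 _ y z (lexx y) yz az).
  apply: H; apply/upset_meetE; split; last exact: upsetP cx.
  by apply/mem_DiaP; exists y, z.
- move=> dp bm a c /upset_leE H; apply/upset_leE.
  move=> x /mem_DiaP[y [z [yx yz az]]].
  have /H/upset_joinE[/mem_BoxM ya|] : upset_val (mop dp a) y.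
  + by apply/mem_DiaP; exists y, z.
  + by case: (ya y z (lexx y) yz az).
  + exact: upsetP yx.
- move=> dm bp a c /upset_leE H; apply/upset_leE.
  move=> x /mem_DiaM[y [z [yx yz az]]].
  have /H/upset_joinE[/mem_BoxP ya|] : upset_val (mop dm a) y.
  + by apply/mem_DiaM; exists y, z.
  + by case: az; exact: (ya y z (lexx y) yz).
  + exact: upsetP yx.
- move=> bp dp a b c /upset_leE H; apply/upset_leE.
  move=> x /upset_meetE[/mem_BoxP xab cx]; apply/mem_BoxP => y z xy yz.
  have /upset_joinE[//|bz] := xab _ _ xy yz.
  apply: ((mem_BoxP bp a y).1 _ y z (lexx y) yz).
  apply: H; apply/upset_meetE; split; last exact: upsetP cx.
  by apply/mem_DiaP; exists y, z.
- move=> bm dm a b c /upset_leE H; apply/upset_leE.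
  move=> x /upset_meetE[/mem_BoxM xab cx]; apply/mem_BoxM => y z xy yz az.
  apply: ((mem_BoxM bm a y).1 _ y z (lexx y) yz az).
  apply: H; apply/upset_meetE; split; last exact: upsetP cx.
  apply/mem_DiaM; exists y, z; split=> // bz.
  by apply: (xab _ _ xy yz); apply/upset_meetE.
- move=> dp bp a b c /upset_leE H; apply/upset_leE.
  move=> x /mem_DiaP[y [z [yx yz az]]]; apply/upset_joinE.
  have /H/upset_joinE[/mem_BoxP yb|cy] : upset_val (mop dp a) y.
  + by apply/mem_DiaP; exists y, z.
  + left; apply/mem_DiaP; exists y, z; split=> //; apply/upset_meetE.
    by split=> //; exact: yb (lexx y) yz.
  + by right; exact: upsetP cy.
- move=> dm bm a b c /upset_leE H; apply/upset_leE.
  move=> x /mem_DiaM[y [z [yx yz az]]]; apply/upset_joinE.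
  have /H/upset_joinE[/mem_BoxM yb|cy] : upset_val (mop dm a) y.
  + by apply/mem_DiaM; exists y, z.
  + left; apply/mem_DiaM; exists y, z; split=> // /upset_joinE[//|].
    exact: yb (lexx y) yz.
  + by right; exact: upsetP cy.
Qed.

End ComplexAlgebra.

(** * The unimodal laws as universal sentences *)

Section UniversalLaws.
Variables (L : {pred modsym}) (e : expansion).

Definition FLe (t u : term L e) : qf_formula L e := FEq (TMeet t u) t.

Lemma holds_FLe (A : modalAlgebra L e) (v : nat -> A) t u :
  holds v (FLe t u) <-> eval v t <= eval v u.
Proof. by split=> /meet_idPl. Qed.

Lemma unimodal_of_universal_theory (A : modalAlgebra L e) :
    (forall phi, (forall C : modalAlgebra L e, unimodal C -> satisfies C phi) ->
      satisfies A phi) ->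
  unimodal A.
Proof.
move=> T.
(* The default [c] of [nth] serves as the value of [Z]. Laws in fewer variables repeat [a] as a
   filler. *)
pose val3 (a b c : A) (n : nat) := nth c [:: a; b] n.
pose X : term L e := Var _ _ 0; pose Y : term L e := Var _ _ 1.
pose Z : term L e := Var _ _ 2.
have law t u :
    (forall C : modalAlgebra L e, unimodal C ->
      forall v : nat -> C, eval v t <= eval v u) ->
    forall v : nat -> A, eval v t <= eval v u.
  by move=> h v; apply/holds_FLe; apply: T => C uC w; apply/holds_FLe/h.
have rule t u t' u' :
    (forall C : modalAlgebra L e, unimodal C ->
      forall v : nat -> C, eval v t <= eval v u -> eval v t' <= eval v u') ->
    forall v : nat -> A, eval v t <= eval v u -> eval v t' <= eval v u'.
  move=> h v /holds_FLe tu; apply/holds_FLe.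
  apply: (T (FImplies (FLe t u) (FLe t' u')) _ v tu) => C uC w /= wtu.
  by apply/holds_FLe/h => //; exact/holds_FLe.
split.
- move=> bp bm a b.
  apply: (law (TMeet (TMod bm X) (TMod bp (TJoin X Y))) (TMod bp Y) _
    (val3 a b a)) => C uC v; exact: uni_BoxP_BoxM.
- move=> bm bp a b.
  apply: (law (TMeet (TMod bp X) (TMod bm (TMeet X Y))) (TMod bm Y) _
    (val3 a b a)) => C uC v; exact: uni_BoxM_BoxP.
- move=> dp dm a b.
  apply: (law (TMod dp Y) (TJoin (TMod dp (TMeet X Y)) (TMod dm X)) _
    (val3 a b a)) => C uC v; exact: uni_DiaP_DiaM.
- move=> dm dp a b.
  apply: (law (TMod dm Y) (TJoin (TMod dm (TJoin X Y)) (TMod dp X)) _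
    (val3 a b a)) => C uC v; exact: uni_DiaM_DiaP.
- move=> bp dm a c.
  apply: (rule (TMeet (TMod dm X) Z) (TMod bp X) Z (TMod bp X) _
    (val3 a a c)) => C uC v; exact: uni_BoxP_DiaM.
- move=> bm dp a c.
  apply: (rule (TMeet (TMod dp X) Z) (TMod bm X) Z (TMod bm X) _
    (val3 a a c)) => C uC v; exact: uni_BoxM_DiaP.
- move=> dp bm a c.
  apply: (rule (TMod dp X) (TJoin (TMod bm X) Z) (TMod dp X) Z _
    (val3 a a c)) => C uC v; exact: uni_DiaP_BoxM.
- move=> dm bp a c.
  apply: (rule (TMod dm X) (TJoin (TMod bp X) Z) (TMod dm X) Z _
    (val3 a a c)) => C uC v; exact: uni_DiaM_BoxP.
- move=> bp dp a b c.
  apply: (rule (TMeet (TMod dp Y) Z) (TMod bp X)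
    (TMeet (TMod bp (TJoin X Y)) Z) (TMod bp X) _
    (val3 a b c)) => C uC v; exact: uni_BoxP_DiaP.
- move=> bm dm a b c.
  apply: (rule (TMeet (TMod dm Y) Z) (TMod bm X)
    (TMeet (TMod bm (TMeet X Y)) Z) (TMod bm X) _
    (val3 a b c)) => C uC v; exact: uni_BoxM_DiaM.
- move=> dp bp a b c.
  apply: (rule (TMod dp X) (TJoin (TMod bp Y) Z)
    (TMod dp X) (TJoin (TMod dp (TMeet X Y)) Z) _
    (val3 a b c)) => C uC v; exact: uni_DiaP_BoxP.
- move=> dm bm a b c.
  apply: (rule (TMod dm X) (TJoin (TMod bm Y) Z)
    (TMod dm X) (TJoin (TMod dm (TJoin X Y)) Z) _
    (val3 a b c)) => C uC v; exact: uni_DiaM_BoxM.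
Qed.

End UniversalLaws.

Theorem mainTheorem7 (L : {pred modsym}) (e : expansion)
    (A : modalAlgebra L e) :
  unimodal A <->
  (forall phi : qf_formula L e,
     (forall F : frame L,
        unimodal_frame F -> satisfies (complex_algebra F e) phi) ->
     satisfies A phi).
Proof.
split=> [uA phi valid v|valid].
  by apply/holds_canonical/valid; exact: canonical_frame_unimodal.
(* A sentence true in all unimodal algebras is true in the complex algebras of unimodal frames,
   hence in [A]. *)
apply: unimodal_of_universal_theory => phi univ; apply: valid => F [R FR].
by apply: univ; exact: complex_algebra_unimodal FR.
Qed.
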